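(* Let $\{x_k\}_{k\ge 0}$ be a sequence generated by the inexact SQA algorithm described in the context, with any one of the four line searches LS1, LS2, LS3, LS4. Suppose that $F$ satisfies the $\mu$-quadratic growth condition for some $\mu>0$, and that $\inf_{k\ge 0}\alpha_k\ge\underline{\alpha}$ for some $\underline{\alpha}>0$. Then: (i) The function value sequence $\{F(x_k)\}$ is Q-linearly convergent to $F^\ast$, i.e. there is a constant $c\in(0,1)$ such that $F(x_{k+1})-F^\ast\le c\,(F(x_k)-F^\ast)$ for all $k\ge 0$. (ii) The iterate sequence $\{x_k\}$ converges R-linearly to an optimal point $x^\ast\in\mathcal{X}$, i.e. $\limsup_{k\to+\infty}\|x_k-x^\ast\|^{1/k}<1$.
   Context: Setting. $\mathcal{H}$ is a real Hilbert space with norm $\|\cdot\|$ and inner product $\langle\cdot,\cdot\rangle$. $F:=f+g$, where $f,g:\mathcal{H}\to(-\infty,\infty]$ are proper lower semicontinuous convex functions with $\operatorname{dom} g\subset\operatorname{int}(\operatorname{dom} f)$ (so $\operatorname{dom}F=\operatorname{dom}g$). $f$ is Fréchet differentiable on an open set containing $\operatorname{dom} g$, and $\nabla f$ is continuous on $\operatorname{dom} g$. The set $\mathcal{X}$ of minimizers of $F$ is nonempty and $F^\ast:=\min F\in\mathbb{R}$. $P_{\mathcal{X}}$ is the metric projection onto the nonempty closed convex set $\mathcal{X}$. Metrics. $H_k:\mathcal{H}\to\mathcal{H}$ ($k\ge0$) are positive self-adjoint operators, $\langle\cdot,\cdot\rangle_k=\langle\cdot,H_k\cdot\rangle$ are inner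 products with induced norms $\|\cdot\|_k$, and there are constants $m,M>0$ with $m\|\cdot\|^2\le\|\cdot\|_k^2\le M\|\cdot\|^2$ for all $k\ge0$. Algorithm (inexact SQA). Fix $\eta\in(0,1]$, $x_0\in\operatorname{dom}F$, and one of the line searches below. For $k=0,1,2,\dots$, let $Q_k(x):=\langle\nabla f(x_k),x-x_k\rangle+g(x)-g(x_k)+\frac12\|x-x_k\|_k^2$ and $Q_k^\ast:=\min_{x\in\mathcal{H}}Q_k(x)$. Choose any $\bar x_{k+1}$ with $Q_k(\bar x_{k+1})\le\eta\,(Q_k^\ast-Q_k(x_k))$ (note $Q_k(x_k)=0$), put $d_k:=\bar x_{k+1}-x_k$, determine $\alpha_k$ by the line search, and set $x_{k+1}:=x_k+\alpha_k d_k$. Line searches. In each case $\beta\in(0,1)$, $\bar\alpha\in(0,1]$, and $\alpha_k$ is the largest $\alpha\in\{\bar\alpha\beta^i: i=0,1,2,\dots\}$ satisfying: LS1 ($\gamma\in(0,1)$): $F(x_k+\alpha d_k)-F(x_k)\le\gamma\alpha\big(\langle\nabla f(x_k),d_k\rangle+g(\bar x_{k+1})-g(x_k)\big)$. LS2 ($\gamma\in(0,m/2)$): $\alpha\|\nabla f(x_k+\alpha d_k)-\nabla f(x_k)\|\le\gamma\|\alpha d_k\|$. LS3 ($\gamma\in(0,1)$): $F(x_k+\alpha d_k)-F(x_k)\le\alpha\big(\langle\nabla f(x_k),d_k\rangle+g(\bar x_{k+1})-g(x_k)+\frac{\gamma}{2}\|d_k\|_k^2\big)$. LS4 ($\gamma\in(0,1)$):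 $f(x_k+\alpha d_k)-f(x_k)\le\alpha\big(\langle\nabla f(x_k),d_k\rangle+\frac{\gamma}{2}\|d_k\|_k^2\big)$. Quadratic growth. $F$ satisfies the $\mu$-quadratic growth condition ($\mu>0$) if $F(x)-F^\ast\ge\frac{\mu}{2}\|x-P_{\mathcal{X}}(x)\|^2$ for all $x\in\operatorname{dom}F$. *)

(* Defs.v *)
From HB Require Import structures.
From mathcomp Require Import all_boot all_order all_algebra.
From mathcomp Require Import sesquilinear.
From mathcomp Require Import all_classical all_reals all_analysis.

Set Implicit Arguments.
Unset Strict Implicit.
Unset Printing Implicit Defensive.

Import Order.TTheory GRing.Theory Num.Theory.
Import numFieldNormedType.Exports.

Local Open Scope classical_set_scope.
Local Open Scope ring_scope.

Section ConvexFunctions.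
Context {R : realType} {H : normedModType R}.
Implicit Types (f : H -> \bar R) (A : set H).
Local Open Scope ereal_scope.

Definition edom f : set H := [set x | f x < +oo].

Definition proper_fun f := (forall x, -oo < f x) /\ edom f !=set0.

(* Under properness the right-hand side never meets -oo. *)
Definition econvex f := forall (x y : H) (t : R), (0 < t < 1)%R ->
  f (t *: x + (1 - t) *: y)%R <= t%:E * f x + (1 - t)%:E * f y.

(* The minimum value of f whenever a minimizer exists. *)
Definition minval f : \bar R := ereal_inf (range f).

Definition minimizers f : set H := [set x | forall y, f x <= f y].

(* The metric projection onto A; the chosen point is the nearest one as soon as
   A is nonempty, closed and convex in a Hilbert space. *)
Definition metric_proj A (x : H) : H :=
  get [set p | A p /\ forall y, A y -> (`|x - p| <= `|x - y|)%R].

Definition quadratic_growth f (mu : R) := forall x, edom f x ->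
  (mu / 2 * `|x - metric_proj (minimizers f) x| ^+ 2)%:E <= f x - minval f.

End ConvexFunctions.

Section HilbertSpace.
Context {R : realType} {H : completeNormedModType R}.
Variable dot : {dot H for idfun}.

(* With this compatibility, (H, dot) is a real Hilbert space whose norm is the
   one of the complete normed module H. *)
Definition norm_of_dot := forall x : H, dot x x = `|x| ^+ 2.

Definition self_adjoint (A : H -> H) := forall x y, dot (A x) y = dot x (A y).

Definition positive_op (A : H -> H) := forall x, 0 <= dot x (A x).

Definition metric_norm (A : H -> H) (x : H) : R := Num.sqrt (dot x (A x)).

(* Riesz representative of the Frechet derivative at x of f, an extended-valued
   function that is meant to be finite around x. *)
Definition grad (f : H -> \bar R) (x : H) : H :=
  get [set v | forall h, 'd (fine \o f) x h = dot v h].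

Definition differentiable_on_nbhs_of (f : H -> \bar R) (A : set H) :=
  exists U : set H, [/\ open U, A `<=` U,
    forall x, U x -> f x \is a fin_num &
    forall x, U x -> differentiable (fine \o f) x].

Section SQA.
Variables (f g : H -> \bar R).
Local Notation F := (f \+ g)%E.

Definition lin_model (x z : H) : \bar R :=
  ((dot (grad f x) (z - x))%:E + g z - g x)%E.

Definition quad_model (A : H -> H) (x z : H) : \bar R :=
  (lin_model x z + (metric_norm A (z - x) ^+ 2 / 2)%:E)%E.

Inductive line_search := LS1 | LS2 | LS3 | LS4.

Definition ls_gamma_range (ls : line_search) (m gamma : R) : bool :=
  match ls with
  | LS2 => 0 < gamma < m / 2
  | _ => 0 < gamma < 1
  end.

(* The test for the step size a at the point x, with trial point z, direction
   d = z - x and metric operator A. *)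
Definition ls_test (ls : line_search) (gamma : R) (A : H -> H) (x z : H)
    (a : R) : Prop :=
  let d := z - x in
  match ls with
  | LS1 => (F (x + a *: d)%R - F x <= (gamma * a)%:E * lin_model x z)%E
  | LS2 => a * `|grad f (x + a *: d) - grad f x| <= gamma * `|a *: d|
  | LS3 => (F (x + a *: d)%R - F x <=
             a%:E * (lin_model x z + (gamma / 2 * metric_norm A d ^+ 2)%:E))%E
  | LS4 => (f (x + a *: d)%R - f x <=
             a%:E * (dot (grad f x) d + gamma / 2 * metric_norm A d ^+ 2)%:E)%E
  end.

Definition largest_backtrack (abar beta : R) (T : R -> Prop) (a : R) :=
  [/\ exists i : nat, a = abar * beta ^+ i, T a &
      forall i : nat, T (abar * beta ^+ i) -> abar * beta ^+ i <= a].

(* z k is the inexact minimizer of the k-th model, i.e. the point usually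
   written with a bar and index k+1. *)
Definition inexact_SQA (Hk : nat -> H -> H) (eta : R) (ls : line_search)
    (abar beta gamma : R) (x z : nat -> H) (alpha : nat -> R) :=
  edom F (x 0%N) /\
  forall k,
    [/\ (quad_model (Hk k) (x k) (z k) <=
          eta%:E * (minval (quad_model (Hk k) (x k))
                    - quad_model (Hk k) (x k) (x k)))%E,
        largest_backtrack abar beta
          (ls_test ls gamma (Hk k) (x k) (z k)) (alpha k) &
        x k.+1 = x k + alpha k *: (z k - x k)].

End SQA.
End HilbertSpace.

(* Main.v *)
Require Import Defs.
From HB Require Import structures.
From mathcomp Require Import all_boot all_order all_algebra.
From mathcomp Require Import sesquilinear.
From mathcomp Require Import all_classical all_reals all_analysis.
From mathcomp Require Import ring lra.

(** Write D for the optimality gap F x - F* at an iterate x, and d = z - x for the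
    direction given by the inexact minimiser z of the model at x.

    The model is small at z. Linearising f underestimates it, so moving a
    fraction t from x towards a nearest minimiser p gives a model value of at
    most - t D + t^2 (M/2) |x - p|^2. Quadratic growth bounds |x - p|^2 by
    2 D / mu, and t = min (1, mu / (2 M)) makes this at most - t D / 2. An inexact
    minimiser thus has model value at most - eta t D / 2 ([model_decrease]).

    The model controls the decrease of F. Each of the four tests bounds the
    increase of F over a step a by a tau times the linear model, plus a metric
    term with a smaller coefficient than in a tau times the quadratic model.
    Hence F decreases by at least a (tau |model value| + sigma |d|^2) with
    tau, sigma > 0 ([line_search_decrease]).

    Both facts give D_(k+1) <= (1 - a tau kappa) D_k - a sigma |d|^2
    ([sqa_step]), where a lies between the lower bound on the step sizes and 1.
    Dropping the last term proves the Q-linear convergence of the values.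
    Dropping the new gap instead bounds |d|^2 by a multiple of D_k, so the steps
    decay geometrically. The iterates are therefore Cauchy and converge
    R-linearly ([cvg_of_geometric_steps], [limn_esup_root_lt1]), and by lower
    semicontinuity their limit is a minimiser.

    The gradient and the metric projection are defined by choice. Their defining
    properties rest on the Riesz representation and on nearest points in closed
    convex sets, and both come from one argument: a minimising sequence of a
    functional with a parallelogram-type midpoint inequality is Cauchy
    ([exists_minimizer_of_midpoint]). *)

Set Implicit Arguments.
Unset Strict Implicit.
Unset Printing Implicit Defensive.

Import Order.TTheory GRing.Theory Num.Theory.
Import numFieldNormedType.Exports.

Local Open Scope classical_set_scope.
Local Open Scope ring_scope.

(** * Minimisation in Hilbert spaces *)

Section Completeness.
Context {R : realType} {H : completeNormedModType R}.

(** Completeness in a quantitative form: explicit control of the tails gives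
    a limit and the same bound on the distance to it. *)
Lemma cvg_of_tail_bound (u : nat -> H) (e : nat -> R) :
  (forall k n, (k <= n)%N -> `|u n - u k| <= e k) -> e @ \oo --> 0 ->
  exists l, u @ \oo --> l /\ forall k, `|u k - l| <= e k.
Proof.
move=> ue e0.
have cu : cvgn u.
  apply/cauchy_cvgP; apply/cauchy_exP => r r0.
  have /cvgrPdist_lt /(_ r r0)[N _ HN] := e0.
  exists (u N); exists N => // n /= Nn; rewrite -ball_normE /= distrC.
  apply: (le_lt_trans (ue N n Nn)).
  by have := HN N (leqnn N); rewrite sub0r normrN /=; exact/le_lt_trans/ler_norm.
exists (limn u); split => // k.
have : (fun n => `|u k - u n|) @ \oo --> `|u k - limn u|.
  by apply: cvg_norm; apply: cvgB => //; exact: cvg_cst.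
move=> cv; apply: (cvgr_to_le cv).
by exists k => // n /= kn; rewrite distrC; exact: ue.
Qed.

(** The common core of the projection and Riesz theorems. Midpoints stay in [A],
    so their values are at least [inf phi]; the quadratic gain in the midpoint
    inequality then forces minimising sequences to be Cauchy. *)
Lemma exists_minimizer_of_midpoint (A : set H) (phi : H -> R) (b : R) :
  closed A -> A !=set0 -> (forall u v, A u -> A v -> A (2^-1 *: (u + v))) ->
  continuous phi -> (forall u, A u -> b <= phi u) ->
  (forall u v, A u -> A v ->
    phi (2^-1 *: (u + v)) <= (phi u + phi v) / 2 - `|u - v| ^+ 2 / 4) ->
  exists2 p, A p & forall u, A u -> phi p <= phi u.
Proof.
move=> Acl [a Aa] Amid phic phib phimid.
have hinf : has_inf (phi @` A).
  by split; [exists (phi a), a | exists b => _ [u Au <-]; exact: phib].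
set i := inf (phi @` A).
have iP u : A u -> i <= phi u.
  by move=> Au; apply: ge_inf; [exact: hinf.2 | exists u].
have /choice[u uP] : forall n : nat, exists u, A u /\ phi u < i + n.+1%:R^-1.
  move=> n; have [|_ [v Av <-] iv] := @inf_adherent _ (phi @` A) n.+1%:R^-1 _ hinf.
    by rewrite invr_gt0.
  by exists v.
pose e k : R := Num.sqrt (4 * k.+1%:R^-1).
have inv0 : (fun k : nat => k.+1%:R^-1 : R) @ \oo --> 0 by exact: cvg_harmonic.
have ue k n : (k <= n)%N -> `|u n - u k| <= e k.
  move=> kn; rewrite -[leLHS]normr_id -sqrtr_sqr ler_wsqrtr//.
  have [[Ak k1] [An n1]] := (uP k, uP n).
  have nk : n.+1%:R^-1 <= k.+1%:R^-1 :> R by rewrite lef_pV2 ?posrE// ler_nat.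
  have := phimid _ _ An Ak; have := iP _ (Amid _ _ An Ak).
  move: k1 n1 nk; set ik := k.+1%:R^-1; set iN := n.+1%:R^-1; set nn := `|_| ^+ 2.
  lra.
have e0 : e @ \oo --> 0.
  have : 4 * k.+1%:R^-1 @[k --> \oo] --> (4 * 0 : R) by exact: cvgMl_tmp.
  rewrite mulr0 => h; rewrite -(sqrtr0 R).
  exact: (cvg_comp _ _ h (@sqrt_continuous R 0)).
have [p [up pe]] := cvg_of_tail_bound ue e0.
exists p.
  by apply: (closed_cvg _ Acl _ _ up); near=> n; exact: (uP n).1.
move=> v Av; apply: le_trans (iP _ Av).
have cv : phi (u n) @[n --> \oo] --> phi p by apply: cvg_comp up _; exact: phic.
have ci : (i + n.+1%:R^-1) @[n --> \oo] --> i.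
  have : (i + n.+1%:R^-1) @[n --> \oo] --> i + 0.
    by apply: cvgD => //; exact: cvg_cst.
  by rewrite addr0.
apply: (ler_cvg_to cv ci).
by near=> n; apply/ltW; exact: (uP n).2.
Unshelve. all: by end_near. Qed.

End Completeness.

Section Hilbert.
Context {R : realType} {H : completeNormedModType R}.
Variable dot : {dot H for idfun}.
Hypothesis dotE : norm_of_dot dot.

Lemma dotC u v : dot u v = dot v u.
Proof. by rewrite (hermitian_subproof u v) expr0 mul1r. Qed.

Lemma dotDr u v w : dot u (v + w) = dot u v + dot u w.
Proof. exact: linearDr. Qed.

Lemma dotBr u v w : dot u (v - w) = dot u v - dot u w.
Proof. exact: linearBr. Qed.

Lemma dotZr a u v : dot u (a *: v) = a * dot u v.
Proof. by rewrite linearZr_LR. Qed.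

Lemma dotDl u v w : dot (v + w) u = dot v u + dot w u.
Proof. exact: linearDl. Qed.

Lemma dotBl u v w : dot (v - w) u = dot v u - dot w u.
Proof. exact: linearBl. Qed.

Lemma dotZl a u v : dot (a *: v) u = a * dot v u.
Proof. by rewrite linearZl_LR. Qed.

Lemma dot0r u : dot u 0 = 0.
Proof. by rewrite -(scale0r u) dotZr mul0r. Qed.

Lemma dot0l u : dot 0 u = 0.
Proof. by rewrite dotC dot0r. Qed.

Definition dot_lin := (dotBr, dotBl, dotDr, dotDl, dotZr, dotZl).

(** The parallelogram identity, solved for the midpoint: it is what makes
    [exists_minimizer_of_midpoint] applicable to squared distances. *)
Lemma norm_midpoint (u v : H) :
  `|2^-1 *: (u + v)| ^+ 2 = (`|u| ^+ 2 + `|v| ^+ 2) / 2 - `|u - v| ^+ 2 / 4.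
Proof.
rewrite -!dotE !dot_lin (dotC v u).
lra.
Qed.

Lemma dot_le_norm u v : dot u v <= `|u| * `|v|.
Proof.
have [->|v0] := eqVneq v 0.
  by rewrite normr0 mulr0 dot0r.
have : 0 <= `| `|v| *: u - `|u| *: v | ^+ 2 by rewrite sqr_ge0.
rewrite -dotE !dot_lin (dotC v u) !dotE.
have [u0|u0] := eqVneq u 0.
  by rewrite u0 normr0 mul0r dot0l.
have up : 0 < `|u| by rewrite normr_gt0.
have vp : 0 < `|v| by rewrite normr_gt0.
move=> h; rewrite -(@ler_pM2l _ (`|u| * `|v|)) ?mulr_gt0//.
nra.
Qed.

Lemma projection_exists (A : set H) (a : H) : closed A -> A !=set0 ->
  (forall u v, A u -> A v -> A (2^-1 *: (u + v))) ->
  exists p, A p /\ forall u, A u -> `|a - p| <= `|a - u|.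
Proof.
move=> Acl A0 Amid.
have [|u _|u v _ _|p Ap pmin] :=
    @exists_minimizer_of_midpoint _ _ A (fun u => `|a - u| ^+ 2) 0 Acl A0 Amid.
- move=> u.
  apply: (@continuous_comp _ _ _ (fun u => `|a - u|) (fun r : R => r ^+ 2)).
    by apply: cvg_norm; apply: cvgB; [exact: cvg_cst | exact: cvg_id].
  exact: exprn_continuous.
- exact: sqr_ge0.
- have -> : a - 2^-1 *: (u + v) = 2^-1 *: ((a - u) + (a - v)).
    rewrite addrACA -opprD scalerBr; congr (_ - _).
    by rewrite -[X in X + X]scale1r -scalerDl scalerA mulVf ?scale1r.
  rewrite norm_midpoint -(distrC v u); suff -> : a - u - (a - v) = v - u by [].
  by rewrite opprB addrC subrKA.
- exists p; split=> // u /pmin; rewrite ler_sqr ?nnegrE//.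
Qed.

(** The representative of [l] is the minimiser of [`|v|^2 - 2 l v]; the first
    variation of this functional at its minimiser in the direction [h] is
    [2 (dot v h - l h)]. *)
Lemma riesz (l : {linear H -> R}) : continuous l ->
  exists v, forall h, l h = dot v h.
Proof.
move=> lc.
have /linear_bounded_continuous/linear_boundedP[r [_ rP]] := lc.
have {}rP h : `|l h| <= (r + 1) * `|h| by apply: rP; rewrite ltrDl.
have lZ a h : l (a *: h) = a * l h by exact: linearZ.
have [|||u _|u w _ _|v _ vmin] := @exists_minimizer_of_midpoint _ _ [set: H]
    (fun v => `|v| ^+ 2 - 2 * l v) (- (r + 1) ^+ 2) closedT.
- by exists 0.
- by [].
- move=> u; apply: cvgB; last by apply: cvgMl_tmp; exact: lc.
  apply: (@continuous_comp _ _ _ (fun u : H => `|u|) (fun r : R => r ^+ 2)).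
    exact: norm_continuous.
  exact: exprn_continuous.
- have := rP u; have := ler_norm (l u); have := sqr_ge0 (`|u| - (r + 1)).
  nra.
- rewrite norm_midpoint lZ linearD; lra.
exists v => h; apply/eqP; rewrite -subr_eq0; apply/eqP.
have key t : 0 <= t ^+ 2 * `|h| ^+ 2 - 2 * t * (l h - dot v h).
  have := vmin (v + t *: h) I.
  rewrite -!dotE !dot_lin (dotC h v) linearD lZ !dotE.
  lra.
set s := l h - dot v h in key *.
set a := `|h| ^+ 2 in key.
have a0 : 0 <= a by exact: sqr_ge0.
(* The quadratic polynomial t |-> t^2 a - 2 t s has a negative value at
   t = s / (a + 1) unless s = 0. *)
have := key (s / (a + 1)).
have -> : (s / (a + 1)) ^+ 2 * a - 2 * (s / (a + 1)) * s =
          - (s ^+ 2 * (a + 2) / (a + 1) ^+ 2) by field; lra.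
rewrite oppr_ge0 leNgt; have [//|s0] := eqVneq s 0; case/negP.
have a1 : 0 < a + 1 by lra.
rewrite divr_gt0 ?(exprn_gt0 _ a1)// mulr_gt0 ?exprn_even_gt0//; lra.
Qed.

End Hilbert.

(** * Extended-valued convex functions *)

Section Convexity.
Context {R : realType} {H : normedModType R}.
Implicit Types (f g : H -> \bar R).

Lemma edom_fin_num f x : (forall y, -oo < f y)%E -> edom f x ->
  f x \is a fin_num.
Proof. by move=> fNy fx; rewrite fin_numElt fNy; exact: fx. Qed.

(** Convexity written along the segment from [x] and in the reals: this is the
    form in which the line search uses it, and the endpoints [t = 0] and
    [t = 1], excluded from [econvex], are needed for full steps. *)
Lemma econvex_segment f x y (t : R) : (forall u, -oo < f u)%E -> econvex f ->
  f x \is a fin_num -> f y \is a fin_num -> 0 <= t <= 1 ->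
  f (x + t *: (y - x)) \is a fin_num /\
  fine (f (x + t *: (y - x))) <= fine (f x) + t * (fine (f y) - fine (f x)).
Proof.
move=> fNy fc fx fy /andP[t0 t1].
suff h : (f (x + t *: (y - x))%R <=
          (fine (f x) + t * (fine (f y) - fine (f x)))%R%:E)%E.
  have fin : f (x + t *: (y - x)) \is a fin_num.
    by apply: edom_fin_num => //; exact: le_lt_trans h (ltry _).
  by split=> //; rewrite -lee_fin fineK.
have [->|tn0] := eqVneq t 0; first by rewrite scale0r mul0r !addr0 fineK.
have [->|tn1] := eqVneq t 1.
  by rewrite scale1r mul1r addrC subrK [X in X%:E]addrC subrK fineK.
have -> : x + t *: (y - x) = t *: y + (1 - t) *: x.
  by rewrite scalerBr scalerBl scale1r addrCA [x + _]addrC [- _ + x]addrC.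
apply: le_trans (fc y x t _) _; first by rewrite !lt_neqAle eq_sym tn0 t0 tn1.
rewrite -{1}(fineK fx) -{1}(fineK fy) -!EFinM -EFinD lee_fin; lra.
Qed.

Lemma EFin_lt_dense (m : R) (y : \bar R) : (m%:E < y)%E ->
  exists2 a : R, m < a & (a%:E < y)%E.
Proof.
case: y => [s| |]//.
  by rewrite lte_fin => ms; exists ((m + s) / 2); rewrite ?lte_fin; lra.
by move=> _; exists (m + 1); rewrite ?ltry// ltrDl.
Qed.

Lemma lower_semicontinuousD f g : (forall u, -oo < f u)%E ->
  (forall u, -oo < g u)%E -> lower_semicontinuous f ->
  lower_semicontinuous g -> lower_semicontinuous (f \+ g)%E.
Proof.
move=> fNy gNy fl gl x a /= ax.
have [b [c [bf cg abc]]] : exists b c : R,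
    [/\ (b%:E < f x)%E, (c%:E < g x)%E & a <= b + c].
  move: (fNy x) (gNy x) ax; case: (f x) => [r| |]//; case: (g x) => [s| |]// _ _.
  - rewrite -EFinD lte_fin => ars; exists (r - (r + s - a) / 2).
    by exists (s - (r + s - a) / 2); rewrite !lte_fin; split; lra.
  - move=> _; exists (r - 1), (a - r + 1); rewrite lte_fin ltry; split=> //; lra.
  - move=> _; exists (a - s + 1), (s - 1); rewrite lte_fin ltry; split=> //; lra.
  - by move=> _; exists a, 0; rewrite !ltry; split=> //; lra.
have [V xV Vf] := fl _ _ bf; have [W xW Wg] := gl _ _ cg.
exists (V `&` W); first exact: filterI.
move=> y [/Vf fy /Wg gy]; apply: le_lt_trans (lteD fy gy).
by rewrite -EFinD lee_fin.
Qed.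

Lemma adde_gtNy f g : (forall u, -oo < f u)%E -> (forall u, -oo < g u)%E ->
  forall u, (-oo < (f \+ g) u)%E.
Proof. by move=> fNy gNy u; rewrite ltNye adde_eq_ninfty negb_or -!ltNye fNy gNy. Qed.

Lemma econvexD f g : (forall u, -oo < f u)%E -> (forall u, -oo < g u)%E ->
  econvex f -> econvex g -> econvex (f \+ g)%E.
Proof.
move=> fNy gNy fc gc u v t t01.
apply: le_trans (leeD (fc u v t t01) (gc u v t t01)) _.
by rewrite !muleDr ?fin_numE ?ltninfty_adde_def ?inE// addeACA.
Qed.

Lemma minval_minimizer f p : minimizers f p -> minval f = f p.
Proof.
move=> pmin; apply/eqP; rewrite eq_le; apply/andP; split.
  by apply: ereal_inf_lbound; exists p.
by apply: le_ereal_inf_tmp => _ [y _ <-]; exact: pmin.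
Qed.

Lemma minval_le f x : (minval f <= f x)%E.
Proof. by apply: ereal_inf_lbound; exists x. Qed.

Lemma minimizersE f : minval f \is a fin_num -> minimizers f !=set0 ->
  minimizers f = [set x | (f x <= (fine (minval f))%:E)%E].
Proof.
move=> ffin [p pmin]; rewrite fineK//; apply/seteqP; split=> x /= xP.
  by rewrite (minval_minimizer xP).
by move=> y; apply: le_trans xP _; exact: minval_le.
Qed.

Lemma closed_minimizers f : lower_semicontinuous f -> minval f \is a fin_num ->
  minimizers f !=set0 -> closed (minimizers f).
Proof.
move=> fl ffin fmin; rewrite minimizersE//.
rewrite -openC; have /lower_semicontinuousP/(_ (fine (minval f))) := fl.
congr open; apply/seteqP; split=> x /=; rewrite ltNge; last by move/negP.
by move=> h; apply/negP.
Qed.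

Lemma minimizers_midpoint f u v : (forall u, -oo < f u)%E -> econvex f ->
  minval f \is a fin_num -> minimizers f u -> minimizers f v ->
  minimizers f (2^-1 *: (u + v)).
Proof.
have half : (0 : R) <= 2^-1 <= (1 : R) by lra.
have sumhalf : 2^-1 + 2^-1 = 1 :> R by rewrite [RHS]splitr mul1r.
move=> fNy fc ffin um vm.
have fu := minval_minimizer um; have fv := minval_minimizer vm.
have fu' : f u \is a fin_num by rewrite -fu.
have fv' : f v \is a fin_num by rewrite -fv.
have [fin le] := econvex_segment fNy fc fu' fv' half.
have eqm : u + 2^-1 *: (v - u) = 2^-1 *: (u + v).
  have uE : u = 2^-1 *: u + 2^-1 *: u.
    by rewrite -scalerDl sumhalf scale1r.
  by rewrite {1}uE addrC scalerBr subrKA addrC -scalerDr.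
rewrite eqm in fin le *.
rewrite -fu -fv subrr mulr0 addr0 in le.
move=> y; apply: le_trans (minval_le _ y).
by rewrite -(fineK fin) -(fineK ffin) lee_fin.
Qed.

End Convexity.

Section Gradient.
Context {R : realType} {H : completeNormedModType R}.
Variable dot : {dot H for idfun}.
Hypothesis dotE : norm_of_dot dot.
Implicit Types f : H -> \bar R.

(** [grad] is defined by choice, so this is where the existence of a Riesz
    representative of the differential is needed. *)
Lemma gradE f x h : differentiable (fine \o f) x ->
  'd (fine \o f) x h = dot (grad dot f x) h.
Proof.
move=> fd; have [v vP] := riesz dotE (diff_continuous fd).
have := @getPex _ [set v | forall h, 'd (fine \o f) x h = dot v h] (ex_intro _ v vP).
exact.
Qed.

(** The difference quotients of [f] along the segment from [x] to [y] are at most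
    [f y - f x] by convexity, and they tend to the directional derivative. *)
Lemma gradient_inequality f x y : (forall u, -oo < f u)%E -> econvex f ->
  differentiable (fine \o f) x -> f x \is a fin_num -> f y \is a fin_num ->
  dot (grad dot f x) (y - x) <= fine (f y) - fine (f x).
Proof.
move=> fNy fc fd fx fy; rewrite -gradE// -deriveE//.
have := @diff_derivable _ _ _ (fine \o f) x (y - x) fd.
rewrite /derivable => /cvg_ex[l lP].
rewrite /derive (cvg_lim _ lP)//.
have {}lP := cvg_dnbhs_at_right lP.
apply: (cvgr_to_le lP).
near=> t.
have t0 : 0 < t by [].
have [|_] := @econvex_segment _ _ f x y t fNy fc fx fy.
  by rewrite (ltW t0)/=; near: t; exact: nbhs_right_le.
move=> h; rewrite /shift/= [t *: _ + x]addrC.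
have -> : forall a : R, t^-1 *: (a : R^o) = t^-1 * a by [].
by rewrite ler_pdivrMl// lerBlDl.
Unshelve. all: by end_near. Qed.

End Gradient.

(** * One step of the method *)

Section Step.
Context {R : realType} {H : completeNormedModType R}.
Variable dot : {dot H for idfun}.
Hypothesis dotE : norm_of_dot dot.
Variables (f g : H -> \bar R).
Hypotheses (fNy : forall u, (-oo < f u)%E) (gNy : forall u, (-oo < g u)%E).
Hypotheses (f_convex : econvex f) (g_convex : econvex g).
Hypothesis f_fin : forall x, edom g x -> f x \is a fin_num.
Hypothesis f_diff : forall x, edom g x -> differentiable (fine \o f) x.

Local Notation F := (f \+ g)%E.
Local Notation grad := (grad dot f).

Let g_fin x : edom g x -> g x \is a fin_num.
Proof. exact: edom_fin_num. Qed.

(** Real-valued copies of the two models; they agree with the extended-valued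
    ones on the domain of [g], and arithmetic is done on these. *)
Definition rlin_model x z : R :=
  dot (grad x) (z - x) + fine (g z) - fine (g x).

Definition rquad_model (A : H -> H) x z : R :=
  rlin_model x z + metric_norm dot A (z - x) ^+ 2 / 2.

Lemma lin_modelE x z : edom g x -> edom g z ->
  lin_model dot f g x z = (rlin_model x z)%:E.
Proof.
by move=> /g_fin gx /g_fin gz; rewrite /lin_model -(fineK gx) -(fineK gz).
Qed.

Lemma quad_modelE A x z : edom g x -> edom g z ->
  quad_model dot f g A x z = (rquad_model A x z)%:E.
Proof. by move=> gx gz; rewrite /quad_model lin_modelE. Qed.

(** A bounded model value keeps the trial point in the domain of [g]: outside it
    the model is infinite. *)
Lemma quad_model_dom A x z r : edom g x ->
  (quad_model dot f g A x z <= r%:E)%E -> edom g z.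
Proof.
move=> /g_fin gx; rewrite /quad_model /lin_model -(fineK gx) /edom /=.
by move: (gNy z); case: (g z) => [s| |]// _ _; rewrite ltry.
Qed.

Lemma metric_norm0 (A : H -> H) : metric_norm dot A 0 = 0.
Proof. by rewrite /metric_norm dot0l sqrtr0. Qed.

Lemma fine_sum x : edom g x -> fine (F x) = fine (f x) + fine (g x).
Proof. by move=> gx; rewrite fineD ?f_fin ?g_fin. Qed.

Lemma sum_fin_num x : edom g x -> F x \is a fin_num.
Proof. by move=> gx; rewrite fin_numD f_fin ?g_fin. Qed.

Lemma edom_segment x y (t : R) : edom g x -> edom g y -> 0 <= t <= 1 ->
  edom g (x + t *: (y - x)).
Proof.
move=> gx gy t01.
have [+ _] := econvex_segment gNy g_convex (g_fin gx) (g_fin gy) t01.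
by rewrite fin_numElt => /andP[].
Qed.

(** The linear part of the model is a minorant of [F - F x], because
    linearising the convex [f] underestimates it. *)
Lemma rlin_model_le x p : edom g x -> edom g p ->
  rlin_model x p <= fine (F p) - fine (F x).
Proof.
move=> gx gp; rewrite !fine_sum//.
have := gradient_inequality dotE fNy f_convex (f_diff gx) (f_fin gx) (f_fin gp).
rewrite /rlin_model; lra.
Qed.

(** The minimum of the model is bounded by its value at a point [t] of the way
    towards [p]: the linear part contributes [t (F p - F x)] by convexity and
    the metric part is quadratic in [t]. *)
Lemma inexact_model_decrease (A : H -> H) (M eta t : R) x z p :
  (forall v, metric_norm dot A v ^+ 2 <= M * `|v| ^+ 2) -> 0 <= eta ->
  0 <= t <= 1 -> edom g x -> edom g p ->
  (quad_model dot f g A x z <=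
     eta%:E * (minval (quad_model dot f g A x) - quad_model dot f g A x x))%E ->
  edom g z /\ rquad_model A x z <=
    eta * (t * (fine (F p) - fine (F x)) + t ^+ 2 * M / 2 * `|x - p| ^+ 2).
Proof.
move=> AM eta0 t01 gx gp.
have xtE : x + t *: (p - x) - x = t *: (p - x) by rewrite addrC addKr.
have gxt := edom_segment gx gp t01.
have -> : quad_model dot f g A x x = 0%E.
  by rewrite quad_modelE// /rquad_model /rlin_model subrr dot0r metric_norm0
     add0r subrr add0r expr0n mul0r.
have [_ gt_le] := econvex_segment gNy g_convex (g_fin gx) (g_fin gp) t01.
have qt : rquad_model A x (x + t *: (p - x)) <=
    t * (fine (F p) - fine (F x)) + t ^+ 2 * M / 2 * `|x - p| ^+ 2.
  have := AM (t *: (p - x)); rewrite normrZ exprMn real_normK ?num_real//.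
  rewrite distrC => At.
  have := ler_wpM2l (proj1 (andP t01)) (rlin_model_le gx gp).
  rewrite /rquad_model /rlin_model xtE dotZr; lra.
rewrite sube0 => zq.
have {}zq : (quad_model dot f g A x z <= (eta * (t * (fine (F p) - fine (F x)) +
    t ^+ 2 * M / 2 * `|x - p| ^+ 2))%R%:E)%E.
  apply: le_trans zq _; rewrite EFinM lee_wpmul2l ?lee_fin//.
  by apply: le_trans (minval_le _ (x + t *: (p - x))) _; rewrite quad_modelE// lee_fin.
have gz := quad_model_dom gx zq.
by split=> //; rewrite -lee_fin -quad_modelE.
Qed.

(** The growth condition is stated through [metric_proj], a chosen point. The set
    of minimisers is closed and convex, so a nearest point exists and the chosen
    one is a genuine minimiser. *)
Lemma quadratic_growth_minimizer mu x : lower_semicontinuous F ->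
  minval F \is a fin_num -> minimizers F !=set0 -> quadratic_growth F mu ->
  edom F x -> exists2 p, minimizers F p &
    mu / 2 * `|x - p| ^+ 2 <= fine (F x) - fine (minval F).
Proof.
move=> Fl Ffin Fm qg Fx.
have FNy := adde_gtNy fNy gNy.
have Fc := econvexD fNy gNy f_convex g_convex.
have [p [pm pmin]] := projection_exists dotE x (closed_minimizers Fl Ffin Fm) Fm
  (fun u v => minimizers_midpoint FNy Fc Ffin (u := u) (v := v)).
have := @getPex _ [set p | minimizers F p /\
    forall y, minimizers F y -> (`|x - p| <= `|x - y|)%R] (ex_intro _ p (conj pm pmin)).
rewrite -/(metric_proj _ _); set q := metric_proj _ _ => -[qm _].
exists q => //.
have Fxfin := edom_fin_num FNy Fx.
by have := qg x Fx; rewrite -/q -[F x]fineK// -[minval F]fineK// -EFinB lee_fin.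
Qed.

Lemma edom_sum x : edom F x -> edom g x.
Proof.
rewrite /edom /= !ltey; apply: contra_neq => ->.
by rewrite addey// -ltNye.
Qed.

(** Every line search gives a decrease
    [a * (tau * model value - sigma * `|d|^2)]. Here [tau] is the first
    coefficient and [sigma], below, is the second. The term in [tau] yields the
    linear rate of the values, and the one in [sigma] bounds the step length. *)
Definition ls_model_coef (ls : line_search) (gamma : R) : R :=
  if ls is LS1 then gamma else 1.

Definition ls_norm_coef (ls : line_search) (m gamma : R) : R :=
  match ls with
  | LS1 => gamma * m / 2
  | LS2 => m / 2 - gamma
  | _ => (1 - gamma) * m / 2
  end.

Lemma ls_model_coef_gt0 ls m gamma : ls_gamma_range ls m gamma ->
  0 < ls_model_coef ls gamma <= 1.
Proof. by case: ls => //= /andP[g0 g1]; rewrite ?g0 ?ltr01 ?lexx// ltW. Qed.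

Lemma ls_norm_coef_gt0 ls m gamma : 0 < m -> ls_gamma_range ls m gamma ->
  0 < ls_norm_coef ls m gamma.
Proof. by case: ls => //= m0 /andP[g0 g1]; nra. Qed.

(** The backtracking test LS2 controls only gradients. Convexity bounds the
    increase of [f] by its slope at the new point, and the test together with
    Cauchy-Schwarz replaces that slope by the slope at [x]. *)
Lemma gradient_step_le (gamma a : R) x d : 0 < a -> edom g x ->
  edom g (x + a *: d) ->
  a * `|grad (x + a *: d) - grad x| <= gamma * `|a *: d| ->
  fine (f (x + a *: d)) - fine (f x) <=
    a * (dot (grad x) d + gamma * `|d| ^+ 2).
Proof.
have real_arith (p q n e r s : R) : - a * p <= s - r ->
    a * e * n <= gamma * (a * n) * n -> a * (p - q) <= a * (e * n) ->
    r - s <= a * (q + gamma * (n * n)) by lra.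
move=> a0 gx gxa; rewrite normrZ gtr0_norm// => h.
have back : x - (x + a *: d) = (- a) *: d by rewrite opprD addNKr scaleNr.
have hf : - a * dot (grad (x + a *: d)) d <=
    fine (f x) - fine (f (x + a *: d)).
  rewrite -dotZr -back.
  exact: (gradient_inequality dotE fNy f_convex (f_diff gxa) (f_fin gxa) (f_fin gx)).
have hd := dot_le_norm dotE (grad (x + a *: d) - grad x) d.
rewrite dotBl in hd.
have := ler_wpM2l (ltW a0) hd; have := ler_wpM2r (normr_ge0 d) h.
rewrite expr2 => h1 h2; exact: real_arith hf h1 h2.
Qed.

(** In each case the test bounds the increase of [F] by [a * tau] times the linear
    model plus a multiple of the metric term that is strictly smaller than the
    one in [a * tau] times the quadratic model. The gap between the two multiples gives the multiple of [`|d|^2]; for LS2 and LS4 the part of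
    the test about [f] is completed by the convexity of [g]. *)
Lemma line_search_decrease (A : H -> H) ls m gamma a x z :
  (forall v, m * `|v| ^+ 2 <= metric_norm dot A v ^+ 2) ->
  ls_gamma_range ls m gamma -> 0 < a <= 1 ->
  edom g x -> edom g z -> ls_test dot f g ls gamma A x z a ->
  fine (F (x + a *: (z - x))) - fine (F x) <=
    a * (ls_model_coef ls gamma * rquad_model A x z
         - ls_norm_coef ls m gamma * `|z - x| ^+ 2).
Proof.
move=> Am gr /andP[a0 a1] gx gz.
have a01 : 0 <= a <= 1 by rewrite ltW.
have gxa := edom_segment gx gz a01.
have [_ gle] := econvex_segment gNy g_convex (g_fin gx) (g_fin gz) a01.
have {Am} := Am (z - x); rewrite /rquad_model.
set d := z - x in gxa gle *.
set N := metric_norm dot A d ^+ 2; set n := `|d| ^+ 2 => Am.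
have Fxa := sum_fin_num gxa; have Fx := sum_fin_num gx.
have fxa := f_fin gxa; have fx := f_fin gx.
have real_le (h : H -> \bar R) u v r : h u \is a fin_num -> h v \is a fin_num ->
    (h u - h v <= r%:E)%E -> fine (h u) - fine (h v) <= r.
  by move=> hu hv; rewrite -lee_fin EFinB !fineK.
have aAm := ler_wpM2l (ltW a0) Am.
case: ls gr => /andP[g0 g1]; rewrite /ls_test -/d -/N => h.
- rewrite lin_modelE// -EFinM in h; have {}h := real_le F _ _ _ Fxa Fx h.
  have := ler_wpM2l (ltW g0) aAm; rewrite /ls_model_coef /ls_norm_coef; lra.
- have := gradient_step_le a0 gx gxa h; move: aAm gle.
  rewrite /ls_model_coef /ls_norm_coef !fine_sum// /rlin_model -/d -/n; clear.
  lra.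
- rewrite lin_modelE// -EFinD -EFinM in h; have {}h := real_le F _ _ _ Fxa Fx h.
  rewrite /ls_model_coef /ls_norm_coef.
  have g1' : 0 <= 1 - gamma by rewrite subr_ge0 ltW.
  have := ler_wpM2l g1' aAm; lra.
- rewrite -EFinM in h; have {}h := real_le f _ _ _ fxa fx h.
  rewrite /ls_model_coef /ls_norm_coef !fine_sum// /rlin_model -/d.
  have g1' : 0 <= 1 - gamma by rewrite subr_ge0 ltW.
  have := ler_wpM2l g1' aAm; lra.
Qed.

(** The factor obtained from [inexact_model_decrease] with
    [t = min (1, mu / (2 M))], the choice for which quadratic growth makes the
    metric term at most half of the linear gain. *)
Definition model_rate (eta mu M : R) : R := eta * Num.min 1 (mu / (2 * M)) / 2.

Lemma model_rate_bounds (eta mu M : R) : 0 < eta <= 1 -> 0 < mu -> 0 < M ->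
  0 < model_rate eta mu M <= 1 / 2.
Proof.
move=> /andP[e0 e1] mu0 M0; rewrite /model_rate.
have : 0 < Num.min 1 (mu / (2 * M)) <= 1.
  by rewrite lt_min ltr01 ge_min lexx divr_gt0 ?mulr_gt0.
move: (Num.min _ _) => t /andP[t0 t1]; apply/andP; split.
  by rewrite divr_gt0 ?mulr_gt0.
have : eta * t <= 1 by rewrite mulr_ile1// ltW.
lra.
Qed.

(** With [p] a minimiser at which the growth inequality holds, both terms of
    [inexact_model_decrease] are multiples of the optimality gap at [x]. *)
Lemma model_decrease (A : H -> H) (M eta mu : R) x z :
  (forall v, metric_norm dot A v ^+ 2 <= M * `|v| ^+ 2) ->
  0 < eta <= 1 -> 0 < mu -> 0 < M ->
  lower_semicontinuous F -> minval F \is a fin_num -> minimizers F !=set0 ->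
  quadratic_growth F mu -> edom g x ->
  (quad_model dot f g A x z <=
     eta%:E * (minval (quad_model dot f g A x) - quad_model dot f g A x x))%E ->
  edom g z /\
  rquad_model A x z <= - (model_rate eta mu M * (fine (F x) - fine (minval F))).
Proof.
have rateE (s d : R) : - (eta * s / 2 * d) = eta * (- (s / 2) * d) by lra.
have growthE (d n s : R) : s * (s * M * n) <= s * (mu / 2 * n) ->
    s * (mu / 2 * n) <= s * d -> s * (- d) + s ^+ 2 * M / 2 * n <= - (s / 2) * d.
  by lra.
move=> AM /andP[eta0 _] mu0 M0 Fl Ffin Fm qg gx zq.
have Fx : edom F x by have := sum_fin_num gx; rewrite fin_numElt => /andP[].
have [p pm pd] := quadratic_growth_minimizer Fl Ffin Fm qg Fx.
have Fp := minval_minimizer pm.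
have gp : edom g p.
  by apply: edom_sum; move: Ffin; rewrite Fp fin_numElt => /andP[].
set t := Num.min 1 (mu / (2 * M)).
have t01 : 0 <= t <= 1.
  by rewrite le_min ler01 ge_min lexx ltW ?divr_gt0 ?mulr_gt0.
have tM : t * M <= mu / 2.
  by rewrite -ler_pdivlMr// -mulrA -invfM ge_min lexx orbT.
have [gz zle] := inexact_model_decrease AM (ltW eta0) t01 gx gp zq.
split=> //; apply: le_trans zle _; rewrite -Fp /model_rate -/t.
set D := fine (F x) - _.
set n := `|x - p| ^+ 2 in pd *.
have t0 := (andP t01).1.
have n0 : 0 <= n by exact: sqr_ge0.
have h1 := ler_wpM2l t0 (ler_wpM2r n0 tM).
have h2 := ler_wpM2l t0 pd.
suff : t * (fine (minval F) - fine (F x)) + t ^+ 2 * M / 2 * n <= - (t / 2) * D.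
  by move=> le; rewrite rateE; exact: (ler_wpM2l (ltW eta0) le).
rewrite -/D in h2.
have -> : fine (minval F) - fine (F x) = - D by rewrite opprB.
exact: growthE h1 h2.
Qed.

(** One step contracts the optimality gap, up to a term that pays for the squared
    step length. *)
Lemma sqa_step (A : H -> H) ls (m M eta mu gamma a : R) x z :
  (forall v, m * `|v| ^+ 2 <= metric_norm dot A v ^+ 2 <= M * `|v| ^+ 2) ->
  0 < eta <= 1 -> 0 < mu -> 0 < M ->
  lower_semicontinuous F -> minval F \is a fin_num -> minimizers F !=set0 ->
  quadratic_growth F mu -> ls_gamma_range ls m gamma -> 0 < a <= 1 ->
  edom g x ->
  (quad_model dot f g A x z <=
     eta%:E * (minval (quad_model dot f g A x) - quad_model dot f g A x x))%E ->
  ls_test dot f g ls gamma A x z a ->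
  edom g (x + a *: (z - x)) /\
  fine (F (x + a *: (z - x))) - fine (minval F) <=
    (1 - a * (ls_model_coef ls gamma * model_rate eta mu M))
      * (fine (F x) - fine (minval F))
    - a * (ls_norm_coef ls m gamma * `|z - x| ^+ 2).
Proof.
move=> Abound eta01 mu0 M0 Fl Ffin Fm qg gr a01 gx zq test.
have Am v := (andP (Abound v)).1; have AM v := (andP (Abound v)).2.
have [gz qle] := model_decrease AM eta01 mu0 M0 Fl Ffin Fm qg gx zq.
have [a0 a1] := andP a01; have tau0 := ltW (andP (ls_model_coef_gt0 gr)).1.
split; first by apply: edom_segment; rewrite ?(ltW a0).
have := line_search_decrease Am gr a01 gx gz test.
have := ler_wpM2l (ltW a0) (ler_wpM2l tau0 qle).
lra.
Qed.

End Step.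

(** * R-linear convergence *)

Section RLinear.
Context {R : realType}.

(** The stronger invariant [`|u n - u k| <= K (r^k - r^n)], with
    [K = C / (1 - r)], is the one that is stable under adding a step. *)
Lemma cvg_of_geometric_steps (H : completeNormedModType R) (u : nat -> H)
    (C r : R) : 0 <= C -> 0 < r < 1 ->
  (forall k, `|u k.+1 - u k| <= C * r ^+ k) ->
  exists l, u @ \oo --> l /\ forall k, `|u k - l| <= C / (1 - r) * r ^+ k.
Proof.
move=> C0 /andP[r0 r1] step; set K := C / (1 - r).
have K0 : 0 <= K by rewrite divr_ge0// subr_ge0 ltW.
have KE : K * (1 - r) = C by rewrite divfK// gt_eqF// subr_gt0.
apply: cvg_of_tail_bound.
- move=> k n kn; suff : `|u n - u k| <= K * (r ^+ k - r ^+ n).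
    by move/le_trans; apply; rewrite ler_wpM2l// gerBl exprn_ge0// ltW.
  elim: n kn => [|n IH]; first by rewrite leqn0 => /eqP->; rewrite !subrr normr0 mulr0.
  rewrite leq_eqVlt ltnS => /predU1P[->|/IH{}IH].
    by rewrite !subrr normr0 mulr0.
  apply: le_trans (ler_distD (u n) _ _) _; apply: le_trans (lerD (step n) IH) _.
  rewrite exprS -KE; lra.
- have := @cvg_geometric R K r; rewrite gtr0_norm// => /(_ r1); exact.
Qed.

(** Comparing with a ratio [q] strictly between [r] and [1] absorbs the constant
    [K], so that eventually [e k <= q^k] and the roots are at most [q]. *)
Lemma limn_esup_root_lt1 (e : nat -> R) (K r : R) : 0 < r < 1 ->
  (forall k, 0 <= e k <= K * r ^+ k) ->
  (limn_esup (fun k => (e k `^ k%:R^-1)%:E) < 1)%E.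
Proof.
move=> /andP[r0 r1] eK; have [q [q0 rq q1]] : exists q, [/\ 0 < q, r < q & q < 1].
  by exists ((1 + r) / 2); split; lra.
have rq01 : `|r / q| < 1.
  by rewrite ger0_norm ?divr_ge0 ?(ltW r0) ?(ltW q0)// ltr_pdivrMr// mul1r.
have /cvgrPdist_lt/(_ 1 ltr01)[N _ HN] := @cvg_geometric R K _ rq01.
apply: (@le_lt_trans _ _ q%:E); last by rewrite lte_fin.
apply: ge_ereal_inf; exists (ereal_sup ((fun k => (e k `^ k%:R^-1)%:E) @`
    [set k | (N.+1 <= k)%N])).
  by exists [set k | (N.+1 <= k)%N] => //; exists N.+1.
apply: ge_ereal_sup => _ [k /= Nk <-]; rewrite lee_fin.
have [ek0 ek] := andP (eK k).
have k0 : k%:R != 0 :> R by rewrite pnatr_eq0 -lt0n (leq_ltn_trans _ Nk).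
have ekq : e k <= q `^ k%:R.
  rewrite powR_mulrn ?(ltW q0)//; apply: le_trans ek _.
  have -> : K * r ^+ k = K * (r / q) ^+ k * q ^+ k.
    by rewrite -mulrA -exprMn divfK// gt_eqF.
  rewrite -[leRHS]mul1r ler_wpM2r ?exprn_ge0 ?(ltW q0)//.
  have := ltW (HN k (ltnW Nk)); rewrite sub0r normrN; apply: le_trans.
  exact: (ler_norm (K * (r / q) ^+ k)).
have ik0 : 0 <= k%:R^-1 :> R by rewrite invr_ge0 ler0n.
have := ge0_ler_powR ik0 _ _ ekq; rewrite -powRrM mulfV// powRr1 ?(ltW q0)//.
by apply; rewrite nnegrE ?powR_ge0.
Qed.
End RLinear.

(** * The convergence theorem *)

Theorem theorem1 (R : realType) (H : completeNormedModType R)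
    (dot : {dot H for idfun}) (dotE : norm_of_dot dot)
    (f g : H -> \bar R)
    (f_proper : proper_fun f) (f_lsc : lower_semicontinuous f)
    (f_convex : econvex f)
    (g_proper : proper_fun g) (g_lsc : lower_semicontinuous g)
    (g_convex : econvex g)
    (dom_gf : edom g `<=` interior (edom f))
    (f_diff : differentiable_on_nbhs_of f (edom g))
    (grad_cont : {within edom g, continuous (grad dot f)})
    (X_neq0 : minimizers (f \+ g)%E !=set0)
    (Fmin_fin : minval (f \+ g)%E \is a fin_num)
    (Hk : nat -> {linear H -> H})
    (Hk_sa : forall k, self_adjoint dot (Hk k))
    (Hk_pos : forall k, positive_op dot (Hk k))
    (m M : R) (m_gt0 : 0 < m) (M_gt0 : 0 < M)
    (Hk_bounds : forall k x,
      m * `|x| ^+ 2 <= metric_norm dot (Hk k) x ^+ 2 <= M * `|x| ^+ 2)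
    (eta : R) (eta01 : 0 < eta <= 1)
    (ls : line_search) (abar beta gamma : R)
    (beta01 : 0 < beta < 1) (abar01 : 0 < abar <= 1)
    (gammaP : ls_gamma_range ls m gamma)
    (x z : nat -> H) (alpha : nat -> R)
    (x_SQA : inexact_SQA dot f g (fun k => Hk k) eta ls abar beta gamma
               x z alpha)
    (mu : R) (mu_gt0 : 0 < mu) (qg : quadratic_growth (f \+ g)%E mu)
    (alow : R) (alow_gt0 : 0 < alow) (alpha_low : alow <= inf (range alpha)) :
  (exists c : R, 0 < c < 1 /\ forall k,
     ((f \+ g) (x k.+1) - minval (f \+ g) <=
        c%:E * ((f \+ g) (x k) - minval (f \+ g)))%E) /\
  (exists xs : H, minimizers (f \+ g)%E xs /\
     (limn_esup (fun k => (`|x k - xs| `^ (k%:R^-1))%:E) < 1%:E)%E).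
Proof.
have [fNy _] := f_proper; have [gNy _] := g_proper.
have f_fin u : edom g u -> f u \is a fin_num.
  by move=> /dom_gf/interior_subset fu; exact: edom_fin_num.
have f_diff' u : edom g u -> differentiable (fine \o f) u.
  by have [U [_ gU _ dU]] := f_diff => /gU/dU.
have Fl := lower_semicontinuousD fNy gNy f_lsc g_lsc.
have [x0dom sqa] := x_SQA.
have alphaE k : exists i : nat, alpha k = abar * beta ^+ i.
  by have [_ [? _ _] _] := sqa k.
have [beta0 beta1] := andP beta01; have [abar0 abar1] := andP abar01.
have alpha_gt0 k : 0 < alpha k.
  by have [i ->] := alphaE k; rewrite mulr_gt0 ?exprn_gt0.
have alpha_le1 k : alpha k <= 1.
  have [i ->] := alphaE k; have [b0 b1] := (ltW beta0, ltW beta1).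
  by rewrite mulr_ile1 ?(ltW abar0) ?exprn_ge0 ?exprn_ile1.
have alpha_ge k : alow <= alpha k.
  apply: le_trans alpha_low _; apply: ge_inf; last by exists k.
  by exists 0 => _ [i _ <-]; exact: ltW.
set tau := ls_model_coef ls gamma; set sig := ls_norm_coef ls m gamma.
set kap := model_rate eta mu M.
have [tau0 tau1] : 0 < tau /\ tau <= 1 by apply/andP; exact: ls_model_coef_gt0 gammaP.
have sig0 : 0 < sig by exact: ls_norm_coef_gt0 m_gt0 gammaP.
have [kap0 kap1] : 0 < kap /\ kap <= 1 / 2 by apply/andP; exact: model_rate_bounds.
set F := (f \+ g)%E in X_neq0 Fmin_fin qg x0dom Fl *.
(* The optimality gap, in the reals. *)
pose D k := fine (F (x k)) - fine (minval F).
have step k : edom g (x k) -> edom g (x k.+1) /\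
    D k.+1 <= (1 - alpha k * (tau * kap)) * D k
              - alpha k * (sig * `|z k - x k| ^+ 2).
  move=> gx; have [zq [_ test _] xE] := sqa k; rewrite /D xE.
  have ak : 0 < alpha k <= 1 by rewrite alpha_gt0 alpha_le1.
  exact: (sqa_step dotE fNy gNy f_convex g_convex f_fin f_diff' (Hk_bounds k)
    eta01 mu_gt0 M_gt0 Fl Fmin_fin X_neq0 qg gammaP ak gx zq test).
have gx k : edom g (x k).
  by elim: k => [|k /step[]//]; exact: edom_sum fNy _ x0dom.
have Fx k : F (x k) \is a fin_num by exact: sum_fin_num.
have D0 k : 0 <= D k by rewrite subr_ge0 -lee_fin !fineK// minval_le.
have {}step k := (step k (gx k)).2.
have [tk0 tk1] : 0 < tau * kap /\ tau * kap <= 1 / 2.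
  split; first exact: mulr_gt0.
  by apply: le_trans kap1; rewrite ger_pMl.
pose c := 1 - alow * (tau * kap).
have alow1 : alow <= 1 by exact: le_trans (alpha_ge 0%N) (alpha_le1 0%N).
have c01 : 0 < c < 1.
  rewrite subr_gt0 gtrBl mulr_gt0// andbT (@le_lt_trans _ _ (1 / 2))//; last by lra.
  by apply: le_trans tk1; rewrite ger_pMl.
have [c0 c1] := andP c01.
have Dlin k : D k.+1 <= c * D k.
  apply: le_trans (step k) _.
  have h1 : 0 <= alpha k * (sig * `|z k - x k| ^+ 2).
    by rewrite mulr_ge0 ?(ltW (alpha_gt0 k)) ?mulr_ge0 ?(ltW sig0) ?sqr_ge0.
  have h2 := ler_wpM2r (D0 k) (ler_wpM2r (ltW tk0) (alpha_ge k)).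
  rewrite /c; lra.
have Dgeo k : D k <= D 0%N * c ^+ k.
  elim: k => [|k IH]; first by rewrite expr0 mulr1.
  apply: le_trans (Dlin k) _.
  by rewrite exprS mulrCA ler_wpM2l// ltW.
split.
  exists c; split=> // k.
  by have := Dlin k; rewrite -lee_fin EFinM /D !EFinB !fineK.
(* [sqa_step] bounds the squared step by a multiple of the gap, which decays
   like c^k; hence steps decay like r^k with r the square root of c. *)
pose r := Num.sqrt c.
have r01 : 0 < r < 1 by rewrite sqrtr_gt0 c0 -(sqrtr1 R) ltr_sqrt.
have rr k : r ^+ k * r ^+ k = c ^+ k by rewrite -exprMn -expr2 sqr_sqrtr ?ltW.
pose C := Num.sqrt (D 0%N / (alow * sig)).
have xstep k : `|x k.+1 - x k| <= C * r ^+ k.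
  have [_ _ ->] := sqa k; rewrite addrC addKr normrZ gtr0_norm//.
  apply: (@le_trans _ _ `|z k - x k|); first by rewrite ler_piMl.
  rewrite -ler_sqr ?nnegrE ?mulr_ge0 ?sqrtr_ge0 ?exprn_ge0 ?sqrtr_ge0//.
  rewrite exprMn sqr_sqrtr ?divr_ge0 ?mulr_ge0 ?(ltW alow_gt0) ?(ltW sig0)//.
  rewrite [_ ^+ k ^+ 2]expr2 rr mulrAC ler_pdivlMr ?mulr_gt0//.
  apply: le_trans (Dgeo k).
  have h1 := D0 k.+1; have h2 := step k.
  have h3 : 0 <= alpha k * (tau * kap) * D k.
    by rewrite mulr_ge0// mulr_ge0 ?(ltW (alpha_gt0 k)) ?(ltW tk0).
  have n0 : 0 <= sig * `|z k - x k| ^+ 2 by rewrite mulr_ge0 ?sqr_ge0 ?(ltW sig0).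
  have h4 := ler_wpM2r n0 (alpha_ge k).
  lra.
have [r0 r1] := andP r01.
have [xs [xcv xsle]] := cvg_of_geometric_steps (sqrtr_ge0 _) r01 xstep.
exists xs; split.
  (* If F xs exceeded the minimum, lower semicontinuity would keep the gaps
     D k away from 0. *)
  rewrite minimizersE//=; rewrite leNgt; apply/negP => Fxs.
  have [a ma /Fl[V xsV VF]] := EFin_lt_dense Fxs.
  have a0 : 0 < a - fine (minval F) by rewrite subr_gt0.
  have cD : D k @[k --> \oo] --> 0.
    apply: (@squeeze_cvgr _ _ _ _ (cst 0) (geometric (D 0%N) c)); last 2 first.
    - exact: cvg_cst.
    - by apply: cvg_geometric; rewrite gtr0_norm.
    by apply: nearW => k; rewrite /= D0 Dgeo.
  have [N _ DN] := cvgr_lt _ cD _ a0.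
  have [N' _ xN] := xcv _ xsV.
  have := VF _ (xN _ (leq_maxr N N')); apply/negP; rewrite -leNgt.
  have := DN _ (leq_maxl N N'); rewrite /D /= ltrD2r => /ltW.
  by rewrite -lee_fin fineK.
apply: (limn_esup_root_lt1 (K := C / (1 - r)) r01) => k.
by rewrite normr_ge0 xsle.
Qed.
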